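(* Let $\{X_\alpha,f_{\alpha\beta},D\}$ be an inverse limit system for which each factor space $X_\alpha$ is a Hausdorff continuum, each bonding function $f_{\alpha\beta}:X_\beta\to 2^{X_\alpha}$ is upper semi-continuous and surjective, and $D$ is a totally ordered set. Then $\varprojlim\mathbf{f}$ is a Hausdorff continuum if and only if $G_\eta$ is connected for each $\eta\in D$.
   Context: A Hausdorff continuum is a non-empty, compact and connected subset of a Hausdorff space. For a non-empty compact Hausdorff space $X$, $2^X$ denotes the set of non-empty compact subsets of $X$. For non-empty compact Hausdorff spaces $X,Y$, a function $f:X\to 2^Y$ is upper semi-continuous (u.s.c.) if for all $x\in X$ and every open $V\subseteq Y$ containing $f(x)$ there is an open $U\subseteq X$ containing $x$ with $f(u)\subseteq V$ for each $u\in U$ (equivalently, its graph $\{(x,y)\in X\times Y \mid y\in f(x)\}$ is closed). $f$ is surjective if for every $y\in Y$ the set $f^{-1}(y)=\{x\in X\mid y\in f(x)\}$ is non-empty. For u.s.c. $f:X\to 2^Y$ and $g:Y\to 2^Z$, $(g\circ f)(x)=\{z\in Z\mid \exists y\in Y \text{ with } y\in f(x) \text{ and } z\in g(y)\}$. A totally ordered index set is a set $D$ with a reflexive, transitive, antisymmetric and total relation $\preceq$. An inverse limit system $\{X_\alpha,f_{\alpha\beta},D\}$ consists of compact Hausdorff spaces $X_\alpha$ and u.s.c. functions $f_{\alpha\beta}:X_\beta\to 2^{X_\alpha}$ for $\alpha\preceq\beta$ in $D$, where $f_{\alpha\alpha}$ is the identity on $X_\alpha$ (i.e. $f_{\alpha\alpha}(x)=\{x\}$),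 such that the collection $\mathbf{f}=\{f_{\alpha\beta}\mid\alpha\preceq\beta\in D\}$ is exact: $f_{\alpha\beta}\circ f_{\beta\eta}=f_{\alpha\eta}$ for all $\alpha\preceq\beta\preceq\eta$ in $D$. The inverse limit is $\varprojlim\mathbf{f}=\{\mathbf{x}\in\prod_{\alpha\in D}X_\alpha\mid x_\alpha\in f_{\alpha\beta}(x_\beta)\ \forall\,\alpha\preceq\beta\in D\}$, with the subspace topology from the product topology. For $\eta\in D$, $G_\eta=\{\mathbf{x}\in\prod_{\alpha\in D}X_\alpha\mid x_\alpha\in f_{\alpha\beta}(x_\beta)\text{ for all }\alpha\preceq\beta\preceq\eta\}$. *)

(* Defs.v *)
From HB Require Import structures.
From mathcomp Require Import all_boot all_order.
From mathcomp Require Import all_classical.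
From mathcomp Require Import topology.

Set Implicit Arguments.
Unset Strict Implicit.
Unset Printing Implicit Defensive.

Import Order.TTheory.

Local Open Scope order_scope.
Local Open Scope classical_set_scope.

Definition hausdorff_continuum (T : topologicalType) (A : set T) : Prop :=
  [/\ hausdorff_space T, A !=set0, compact A & connected A].

(* 2^Y; a map X -> 2^Y is represented by f : X -> set Y whose values all lie
   in hyperspace Y. *)
Definition hyperspace (Y : topologicalType) : set (set Y) :=
  [set A | A !=set0 /\ compact A].
Arguments hyperspace Y : clear implicits.

Definition usc (X Y : topologicalType) (f : X -> set Y) : Prop :=
  forall (x : X) (V : set Y), open V -> f x `<=` V ->
    exists U : set X, [/\ open U, U x & forall u, U u -> f u `<=` V].

Definition mv_preimage (X Y : Type) (f : X -> set Y) (y : Y) : set X :=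
  [set x | f x y].

Definition mv_surjective (X Y : Type) (f : X -> set Y) : Prop :=
  forall y : Y, mv_preimage f y !=set0.

Definition mv_comp (X Y Z : Type) (g : Y -> set Z) (f : X -> set Y) :
    X -> set Z :=
  fun x => [set z | exists y, f x y /\ g y z].

(* [f a b : X b -> set (X a)] is the bonding function f_{ab}. The family is
   total in (a, b), but only its members with a <= b are ever constrained or
   used. *)
Record inverse_limit_system (d : Order.disp_t) (D : orderType d)
    (X : D -> topologicalType) (f : forall a b : D, X b -> set (X a)) : Prop :=
  InverseLimitSystem {
    ils_hausdorff : forall a, hausdorff_space (X a);
    ils_compact : forall a, compact [set: X a];
    ils_hyperspace : forall a b, a <= b -> forall x, hyperspace (X a) (f a b x);
    ils_usc : forall a b, a <= b -> usc (f a b);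
    ils_id : forall a (x : X a), f a a x = [set x];
    ils_exact : forall a b c, a <= b -> b <= c ->
      mv_comp (f a b) (f b c) = f a c
  }.

Definition inverse_limit (d : Order.disp_t) (D : orderType d)
    (X : D -> topologicalType) (f : forall a b : D, X b -> set (X a)) :
    set (prod_topology X) :=
  [set x | forall a b, a <= b -> f a b (x b) (x a)].

Definition partial_limit (d : Order.disp_t) (D : orderType d)
    (X : D -> topologicalType) (f : forall a b : D, X b -> set (X a)) (eta : D) :
    set (prod_topology X) :=
  [set x | forall a b, a <= b -> b <= eta -> f a b (x b) (x a)].

(* Main.v *)
(* The inverse limit is the directed intersection of the closed sets G_eta, and
   such an intersection of connected sets in a compact Hausdorff space is
   connected. Conversely, exactness and surjectivity extend every thread on
   finitely many indices upwards, so by compactness every point of G_eta agrees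
   on the indices up to eta with some point of the inverse limit. Hence G_eta is
   the union over the points x of the inverse limit of the inverse limit itself
   and the fibre {y | y_a = x_a for all a <= eta}; this fibre is a product of
   continua, so it is connected and meets the inverse limit in x. *)
Require Import Defs.
From mathcomp Require Import all_boot all_order.
From mathcomp Require Import all_classical.
From mathcomp Require Import topology.

Set Implicit Arguments.
Unset Strict Implicit.
Unset Printing Implicit Defensive.

Local Open Scope order_scope.
Local Open Scope classical_set_scope.

Import Order.TTheory.

(** * Closed graphs of upper semi-continuous maps *)

(** If [y] is not in [f x], regularity gives a neighbourhood [B] of [y] whose closure misses [f x];
    by upper semi-continuity the values near [x] miss it too. *)
Lemma closed_mv_graph (X Y : topologicalType) (f : X -> set Y) :
  hausdorff_space Y -> compact [set: Y] -> usc f -> (forall x, compact (f x)) ->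
  closed [set p : X * Y | f p.1 p.2].
Proof.
move=> hY cY uf cf; rewrite -[X in closed X]setCK; apply: open_closedC.
rewrite openE => -[x y] /= nfxy.
have ofx : open (~` f x) by apply: closed_openC; exact: compact_closed.
have [B By clB] := @compact_regular Y y setT hY cY filterT _
  (open_nbhs_nbhs (conj ofx nfxy)).
have [||U [oU Ux fU]] := uf x (~` closure B).
- exact/closed_openC/closed_closure.
- by move=> z fxz /clB.
exists (U, B); first by split => //; exact: open_nbhs_nbhs.
by move=> [u b] /= [Uu Bb] /(fU _ Uu); apply; exact: subset_closure.
Qed.

Lemma closed_mv_preimage (T X Y : topologicalType) (f : X -> set Y)
    (u : T -> X) (v : T -> Y) :
  hausdorff_space Y -> compact [set: Y] -> usc f -> (forall x, compact (f x)) ->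
  continuous u -> continuous v -> closed [set t | f (u t) (v t)].
Proof.
move=> hY cY uf cf cu cv.
apply: (@preimage_closed _ _ (fun t => (u t, v t)) [set p | f p.1 p.2]).
  by move=> t _; apply: cvg_pair; [exact: cu|exact: cv].
exact: closed_mv_graph.
Qed.

(** * Directed intersections of closed sets *)

(** Otherwise the sets [G i] minus [W] generate a proper filter, and a cluster point of it lies in
    every [G i] but outside [W]. *)
Lemma compact_directed_bigcap (T : topologicalType) (I : Type) (i0 : I)
    (G : I -> set T) (W : set T) :
  compact [set: T] -> (forall i, closed (G i)) ->
  (forall i j, exists k, G k `<=` G i `&` G j) ->
  open W -> \bigcap_i G i `<=` W -> exists i, G i `<=` W.
Proof.
move=> cT clG dirG oW GW; apply: contrapT => /forallNP nGW.
pose F := filter_from [set: I] (fun i => G i `\` W).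
have FF : ProperFilter F.
  apply: filter_from_proper => [|i _]; last first.
    by have /existsNP[x /not_implyP Gx] := nGW i; exists x.
  apply: filter_from_filter; first by exists i0.
  move=> i j _ _; have [k kij] := dirG i j; exists k => // x [Gx nWx].
  by have [] := kij x Gx.
have [x [_ Fx]] := cT F FF filterT.
have GWx i : (G i `\` W) x.
  have clGW : closed (G i `\` W) by apply: closedI => //; exact: open_closedC.
  by apply: clGW => B Bx; apply: Fx => //; exists i.
by have [_] := GWx i0; apply; apply: GW => i _; have [] := GWx i.
Qed.

(** Normality puts the two pieces of a separation into separated open sets. Some [G i] already lies
    in their union, hence in one of them, although it contains both pieces. *)
Lemma connected_directed_bigcap (T : topologicalType) (I : Type) (i0 : I)
    (G : I -> set T) :
  hausdorff_space T -> compact [set: T] ->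
  (forall i, closed (G i)) -> (forall i, connected (G i)) ->
  (forall i j, exists k, G k `<=` G i `&` G j) ->
  connected (\bigcap_i G i).
Proof.
move=> hT cT clG coG dirG; apply/connectedP => E [E0 GE [sE1 sE2]].
have clL : closed (\bigcap_i G i) by apply: closed_bigI => i _.
(* Separated pieces of a closed set are themselves closed. *)
have clE0 : closed (E false).
  move=> x clx; have : (\bigcap_i G i) x.
    by apply: clL; apply: closureS clx; rewrite GE => y; left.
  rewrite GE => -[//|E1x].
  by have : set0 x by rewrite -sE1.
have clE1 : closed (E true).
  move=> x clx; have : (\bigcap_i G i) x.
    by apply: clL; apply: closureS clx; rewrite GE => y; right.
  rewrite GE => -[E0x|//].
  by have : set0 x by rewrite -sE2.
have E01 : set_nbhs (E false) (~` E true).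
  move=> x E0x; apply: open_nbhs_nbhs; split; first exact: closed_openC.
  by move=> E1x; have : set0 x by rewrite -sE1; split => //; exact: subset_closure.
have [C /set_nbhsP[U [oU E0U UC]] clC] := compact_normal hT cT clE0 E01.
have oV : open (~` closure C) by exact/closed_openC/closed_closure.
have sUV : separated U (~` closure C).
  split; apply/disjoints_subset.
    by rewrite setCK; exact: closureS.
  apply: subsetCr; have /closure_id -> : closed (~` U) by exact: open_closedC.
  by apply/closureS/subsetC; apply: subset_trans UC _; exact: subset_closure.
have [||i GUV] := @compact_directed_bigcap T I i0 G (U `|` ~` closure C) cT clG dirG.
- exact: openU.
- rewrite GE => x [/E0U|E1x]; first by left.
  by right => /clC.
have EG b : E b `<=` G i.
  suff : E b `<=` \bigcap_i G i by move=> /subset_trans; apply => x; apply.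
  by rewrite GE; case: b => x; [right|left].
have [x0 Ex0] := E0 false; have [x1 Ex1] := E0 true.
have [GU|GV] := connected_subset sUV GUV (coG i).
  have /GU/UC/subset_closure/clC := EG _ _ Ex1; exact.
have /GV := EG _ _ Ex0; apply; exact/subset_closure/UC/E0U.
Qed.

(** * Fibres of the product space *)

Section product.
Context (D : choiceType) (X : D -> topologicalType).

Lemma prod_topology_proj_continuous (a : D) :
  continuous (fun x : prod_topology X => x a).
Proof. exact: (@proj_continuous D X a). Qed.

Lemma prod_topology_hausdorff :
  (forall a, hausdorff_space (X a)) -> hausdorff_space (prod_topology X).
Proof. exact: hausdorff_product. Qed.

Lemma prod_topology_compact :
  (forall a, compact [set: X a]) -> compact [set: prod_topology X].
Proof.
move=> cX; have := @tychonoff D X (fun=> setT) cX.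
by congr compact; apply/seteqP; split.
Qed.

(** The sets of points agreeing with [y] at finitely many indices generate a filter that converges
    to [y] in each coordinate, hence in the product. *)
Lemma nbhs_prod_topology_agree (y : prod_topology X) (U : set (prod_topology X)) :
  nbhs y U ->
  exists s : seq D, [set z | forall a, a \in s -> z a = y a] `<=` U.
Proof.
pose F := filter_from [set: seq D]
  (fun s => [set z : prod_topology X | forall a, a \in s -> z a = y a]).
have FF : Filter F.
  apply: filter_from_filter; first by exists [::].
  move=> s t _ _; exists (s ++ t) => // z zst; split=> a ast; apply: zst.
    by rewrite mem_cat ast.
  by rewrite mem_cat ast orbT.
have : F --> y.
  apply/cvg_sup => a A [B [[C oC <-] Cy] BA]; exists [:: a] => // z zy.
  by apply: BA; rewrite /= zy ?mem_head.
by move=> /[apply] -[s _ sU]; exists s.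
Qed.

Lemma closed_agree (S : set D) (p : prod_topology X) :
  (forall a, hausdorff_space (X a)) ->
  closed [set y : prod_topology X | forall a, S a -> y a = p a].
Proof.
move=> hX.
rewrite (_ : mkset _ = \bigcap_(a in S)
  ((fun y : prod_topology X => y a) @^-1` [set p a])); last first.
  by apply/seteqP; split=> y yp a Sa; exact: yp.
apply: closed_bigI => a _; apply: preimage_closed.
  by move=> y _; exact: prod_topology_proj_continuous.
exact/accessible_closed_set1/hausdorff_accessible.
Qed.

(* The points that differ from [p] at finitely many indices lie in the component
   of [p], and they are dense. *)
Lemma connected_agree (S : set D) (p : prod_topology X) :
  (forall a, hausdorff_space (X a)) -> (forall a, connected [set: X a]) ->
  connected [set y : prod_topology X | forall a, S a -> y a = p a].
Proof.
move=> hX cX; set P := mkset _.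
suff PE : connected_component P p = P by rewrite -PE; exact: component_connected.
apply/seteqP; split=> [|y Py]; first exact: connected_component_sub.
pose mix (s : seq D) : prod_topology X := fun a => if a \in s then y a else p a.
have mixC s : connected_component P p (mix s).
  elim: s => [|a s IHs]; first exact: connected_component_refl.
  have [Sa|nSa] := pselect (S a).
    rewrite (_ : mix (a :: s) = mix s) //; apply: functional_extensionality_dep => b.
    by rewrite /mix inE; have [->|] := eqVneq b a; rewrite //= (Py _ Sa) if_same.
  apply: connected_component_trans IHs _.
  (* Varying only coordinate [a] of [mix s] traces a copy of [X a] inside [P] that joins [mix s] to
     [mix (a :: s)]. *)
  exists (dfwith (mix s : forall a, X a) a @` setT); last first.
    exists (y a) => //; apply: functional_extensionality_dep => b.
    rewrite /mix inE; have [->|ba] := eqVneq b a; first by rewrite dfwithin.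
    by rewrite dfwithout // eq_sym.
  split.
  - exists (mix s a) => //; apply: functional_extensionality_dep => b.
    by case: dfwithP.
  - move=> _ [t _ <-] b Sb; rewrite dfwithout; last first.
      by apply/eqP => ab; apply: nSa; rewrite ab.
    by rewrite /mix Py // if_same.
  - apply: connected_continuous_connected => //.
    by apply: continuous_subspaceT; exact: dfwith_continuous.
have /closure_id -> : closed (connected_component P p).
  by apply: component_closed; exact: closed_agree.
move=> U /nbhs_prod_topology_agree[s sU]; exists (mix s); split => //.
by apply: sU => a sa; rewrite /mix sa.
Qed.

End product.

(** * Threads and their extension *)

Section threads.
Context (d : Order.disp_t) (D : orderType d) (X : D -> topologicalType).
Context (f : forall a b : D, X b -> set (X a)).
Arguments f : clear implicits.

(** Coordinates outside [S] are free, so the inverse limit, the sets G_eta and threads on finite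
    index sets are all instances. *)
Definition thread (S : set D) : set (prod_topology X) :=
  [set x | forall a b, S a -> S b -> a <= b -> f a b (x b) (x a)].

Lemma thread_sub (S S' : set D) : S `<=` S' -> thread S' `<=` thread S.
Proof. by move=> SS' x xS' a b /SS' ? /SS'; exact: xS'. Qed.

Lemma inverse_limitE : inverse_limit f = thread setT.
Proof. by apply/seteqP; split=> x xf a b => [_ _|]; exact: xf. Qed.

Lemma partial_limitE (c : D) : partial_limit f c = thread [set a | a <= c].
Proof.
apply/seteqP; split=> x xf a b => [_ bc ab|ab bc]; apply: xf => //.
exact: le_trans bc.
Qed.

Lemma inverse_limit_bigcap : inverse_limit f = \bigcap_c partial_limit f c.
Proof.
apply/seteqP; split=> x xf; first by move=> c _ a b ab _; exact: xf.
by move=> a b ab; apply: (xf b).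
Qed.

Hypothesis hsys : inverse_limit_system f.

Lemma closed_thread (S : set D) : closed (thread S).
Proof.
have -> : thread S = \bigcap_(p in [set p : D * D | [/\ S p.1, S p.2 & p.1 <= p.2]])
    [set x : prod_topology X | f p.1 p.2 (x p.2) (x p.1)].
  apply/seteqP; split=> x xf; first by move=> [a b] [? ? ?]; exact: xf.
  by move=> a b ? ? ?; apply: (xf (a, b)).
apply: closed_bigI => -[a b] /= [_ _ ab].
apply: (@closed_mv_preimage (prod_topology X) (X b) (X a)).
- exact: ils_hausdorff hsys a.
- exact: ils_compact hsys a.
- exact: ils_usc ab.
- by move=> x; have [] := ils_hyperspace hsys ab x.
- exact: prod_topology_proj_continuous.
- exact: prod_topology_proj_continuous.
Qed.

Hypothesis hsurj : forall a b : D, a <= b -> mv_surjective (f a b).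

(* The chain is climbed upwards: surjectivity gives a value at the next index
   over the current top one, and exactness relates it to all lower indices. *)
Lemma extend_thread_chain (S : set D) (c : D) (x : prod_topology X) (s : seq D) :
  S c -> (forall a, S a -> a <= c) -> thread S x -> path <%O c s ->
  exists2 y, thread (S `|` [set` s]) y & forall a, S a -> y a = x a.
Proof.
move=> Sc; elim: s S c x Sc => [|b s IHs] S c x Sc Smax xS /=.
  move=> _; exists x => //; apply: thread_sub xS.
  by move=> a [//|]; rewrite /= in_nil.
move=> /andP[cb bs].
have [t tc] := hsurj (ltW cb) (x c).
have Sb a : S a -> a < b by move=> /Smax ac; exact: le_lt_trans cb.
pose x' : prod_topology X := dfwith (x : forall a, X a) b t.
have x'S a : S a -> x' a = x a.
  move=> /Sb ab; rewrite /x' dfwithout //.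
  by rewrite gt_eqF.
have x'b : x' b = t by rewrite /x' dfwithin.
have [||||y yf yx'] := IHs (S `|` [set b]) b x'.
- by right.
- by move=> a [/Sb/ltW|->].
- move=> a a' [Sa|->] [Sa'|->] aa'.
  + by rewrite !x'S //; exact: xS.
  (* Exactness factors [f a b] through the old top index [c], with [x c] as the intermediate
     point. *)
  + rewrite x'b x'S // -(ils_exact hsys (Smax _ Sa) (ltW cb)).
    by exists (x c); split => //; apply: xS => //; exact: Smax.
  + by have := le_lt_trans aa' (Sb _ Sa'); rewrite ltxx.
  + by rewrite (ils_id hsys).
- by [].
exists y => [|a Sa]; last by rewrite yx' ?x'S//; left.
apply: thread_sub yf => a [Sa|]; first by left; left.
by rewrite /= inE => /orP[/eqP->|]; [left; right|right].
Qed.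

(** The closed sets in the hypothesis are directed under concatenation of lists and intersect in the
    conclusion's set, so compactness applies. [C] carries a constraint that the limit point must
    keep. *)
Lemma extend_thread (C : set (prod_topology X)) :
  closed C -> (forall s : seq D, C `&` thread [set` s] !=set0) ->
  C `&` inverse_limit f !=set0.
Proof.
move=> clC CS; apply: contrapT => Cf.
have [|||||s] := @compact_directed_bigcap _ _ [::]
    (fun s : seq D => C `&` thread [set` s]) set0.
- exact/prod_topology_compact/(ils_compact hsys).
- by move=> s; apply: closedI => //; exact: closed_thread.
- move=> s t; exists (s ++ t) => x [Cx xst].
  by split; split=> //; apply: thread_sub xst => a /= ast;
    rewrite mem_cat ast ?orbT.
- exact: open0.
- move=> x xC; apply: Cf; exists x; split; first by have [] := xC [::] I.
  move=> a b ab; have [_] := xC [:: a; b] I.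
  by apply => //=; rewrite !inE eqxx ?orbT.
by have [x xs] := CS s => /(_ x xs).
Qed.

(** A finite index set, once sorted, is a chain: an arbitrary value at its least index extends
    upwards along it. *)
Lemma inverse_limit_nonempty : (forall a, [set: X a] !=set0) ->
  inverse_limit f !=set0.
Proof.
move=> X0; pose x0 : prod_topology X := fun a => projT1 (cid (X0 a)).
suff [x [_ xf]] : setT `&` inverse_limit f !=set0 by exists x.
apply: extend_thread => [|s]; first exact: closedT.
have su : sorted <%O (sort <=%O (undup s)).
  by rewrite lt_sorted_uniq_le sort_uniq undup_uniq; exact: sort_sorted le_total _.
have sE a : a \in s -> a \in sort <=%O (undup s) by rewrite mem_sort mem_undup.
case: (sort _ _) su sE => [|c t] /= ct sE.
  by exists x0; split=> // a b /sE; rewrite in_nil.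
have [||||y yf _] := @extend_thread_chain [set c] c x0 t.
- by [].
- by move=> a ->.
- by move=> a b -> -> _; rewrite (ils_id hsys).
- by [].
exists y; split=> //; apply: thread_sub yf => a /sE.
by rewrite inE => /orP[/eqP->|]; [left|right].
Qed.

Lemma extend_partial_limit (c : D) (x : prod_topology X) :
  partial_limit f c x ->
  exists2 y, inverse_limit f y & forall a, a <= c -> y a = x a.
Proof.
rewrite partial_limitE => xc.
suff [y [yx yf]] : [set y | forall a, a <= c -> y a = x a] `&`
    inverse_limit f !=set0 by exists y.
apply: extend_thread => [|s].
  exact/(@closed_agree D X [set a | a <= c])/(ils_hausdorff hsys).
(* Only the indices of [s] above [c] need new values; the others are already served by [x]. *)
have [|||y yf yx] := @extend_thread_chain [set a | a <= c] c x
    (sort <=%O (undup [seq a <- s | c < a])) _ _ xc.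
- exact: lexx.
- by [].
- rewrite path_min_sorted; last first.
    by apply/allP => a; rewrite mem_sort mem_undup mem_filter => /andP[].
  by rewrite lt_sorted_uniq_le sort_uniq undup_uniq; exact: sort_sorted le_total _.
exists y; split=> //; apply: thread_sub yf => a /= sa.
have [ac|ca] := leP a c; first by left.
by right; rewrite /= mem_sort mem_undup mem_filter ca.
Qed.

End threads.

Theorem theorem5p4 (d : Order.disp_t) (D : orderType d)
    (X : D -> topologicalType) (f : forall a b : D, X b -> set (X a))
    (hsys : inverse_limit_system f)
    (hX : forall a : D, hausdorff_continuum [set: X a])
    (hsurj : forall a b : D, a <= b -> mv_surjective (f a b)) :
  hausdorff_continuum (inverse_limit f) <->
  (forall eta : D, connected (partial_limit f eta)).
Proof.
have hD := ils_hausdorff hsys; have cD := ils_compact hsys.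
have coX a : connected [set: X a] by have [] := hX a.
have clG c : closed (partial_limit f c).
  by rewrite partial_limitE; exact: closed_thread.
have fX0 : inverse_limit f !=set0.
  by apply: inverse_limit_nonempty => // a; have [] := hX a.
have subG c : inverse_limit f `<=` partial_limit f c.
  by rewrite inverse_limit_bigcap => x; apply.
split=> [[_ _ _ cof] c|coG].
  have -> : partial_limit f c = \bigcup_(x in inverse_limit f)
      (inverse_limit f `|` [set y | forall a, a <= c -> y a = x a]).
    apply/seteqP; split=> [x xc|x [y yf [/subG//|xy]]].
      have [y yf yx] := extend_partial_limit hsys hsurj xc.
      by exists y => //; right => a ac; rewrite yx.
    move=> a b ab bc; rewrite !xy //; first exact: yf.
    exact: le_trans bc.
  (* All members of the union contain the non-empty inverse limit, and the two parts of each member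
     share [x]. *)
  apply: bigcup_connected => [|x xf].
    by have [x xf] := fX0; exists x => y _; left.
  apply: connectedU => //; first by exists x.
  exact: (@connected_agree D X [set a | a <= c]).
split=> //; first exact: prod_topology_hausdorff.
  have cT := prod_topology_compact cD.
  apply: subclosed_compact cT _ => //; rewrite inverse_limitE; exact: closed_thread.
(* [D] may be empty; the product is then a single point. *)
have [[c0 _]|noD] := pselect (exists c : D, True).
  rewrite inverse_limit_bigcap; apply: (connected_directed_bigcap c0) => //.
  - exact: prod_topology_hausdorff.
  - exact: prod_topology_compact.
  (* The sets G_eta decrease as eta grows, so totality of the order makes them directed. *)
  move=> a b; exists (Order.max a b); rewrite !partial_limitE => x xab.
  by split; apply: thread_sub xab => e /= ea; rewrite le_max ea ?orbT.
have [x xf] := fX0; rewrite (_ : inverse_limit f = [set x]); first exact: connected1.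
apply/seteqP; split=> [y _|_ ->//]; apply: functional_extensionality_dep => a.
by case: noD; exists a.
Qed.
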